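(* The equivalence relation $E^{ce}_{\max}$ is complete under ternary reducibility $\leq_c^3$ among $\Pi^0_2$ equivalence relations (every $\Pi^0_2$ equivalence relation $R$ on $\omega$ satisfies $R\leq_c^3E^{ce}_{\max}$), but it is not complete under $4$-ary reducibility $\leq_c^4$ among $\Pi^0_2$ equivalence relations.
   Context: $W_e$ is the $e$-th c.e. set. $i\,E^{ce}_{\max}\,j\iff\max(W_i)=\max(W_j)$, with the conventions that the empty set has maximum $-\infty$ and every infinite set has maximum $+\infty$. For equivalence relations $E,F$ on $\omega$ and $n\ge1$, $E\leq_c^nF$ means there is a total computable function mapping each $(x_0,\dots,x_{n-1})\in\omega^n$ to $(y_0,\dots,y_{n-1})\in\omega^n$ with $x_i\,E\,x_j\iff y_i\,F\,y_j$ for all $i<j<n$. A $\Pi^0_2$ equivalence relation is an equivalence relation on $\omega$ that is a $\Pi^0_2$ subset of $\omega\times\omega$. *)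

(* Defs.v *)
From Stdlib Require Import Arith List Cantor.
Import ListNotations.

Definition pair (x y : nat) : nat := Cantor.to_nat (x, y).
Definition unpair (n : nat) : nat * nat := Cantor.of_nat n.

(** Programs: unary partial recursive functions over nat, arguments being
    combined with Cantor pairing.  This basis is Turing complete. *)
Inductive code : Type :=
| CZero : code
| CSucc : code
| CId   : code
| CFst  : code
| CSnd  : code
| CPair : code -> code -> code
| CComp : code -> code -> code
| CPrec : code -> code -> code     (* h<y,0> = f y ; h<y,m+1> = g <y,<m,h<y,m>>> *)
| CMu   : code -> code.            (* x |-> least n with f<x,n> = 0 (and f<x,i> defined for i<n) *)

Definition obind (o : option nat) (k : nat -> option nat) : option nat :=
  match o with Some a => k a | None => None end.

(** Step-indexed evaluation: [eval k c x = Some v] iff the computation of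
    [c] on [x] converges to [v] within "fuel" [k] (sound, and complete for
    large enough fuel). *)
Fixpoint eval (k : nat) (c : code) (x : nat) : option nat :=
  match k with
  | 0 => None
  | S k' =>
    match c with
    | CZero => Some 0
    | CSucc => Some (S x)
    | CId => Some x
    | CFst => Some (fst (unpair x))
    | CSnd => Some (snd (unpair x))
    | CPair f g =>
        obind (eval k' f x) (fun a => obind (eval k' g x) (fun b => Some (pair a b)))
    | CComp f g => obind (eval k' g x) (fun a => eval k' f a)
    | CPrec f g =>
        let y := fst (unpair x) in
        (fix loop (m : nat) : option nat :=
           match m with
           | 0 => eval k' f y
           | S m' => obind (loop m') (fun r => eval k' g (pair y (pair m' r)))
           end) (snd (unpair x))
    | CMu f =>
        (fix search (i fuel : nat) : option nat :=
           match fuel with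
           | 0 => None
           | S fuel' =>
             match eval k' f (pair x i) with
             | Some 0 => Some i
             | Some (S _) => search (S i) fuel'
             | None => None
             end
           end) 0 k
    end
  end.

Fixpoint decode_aux (fuel n : nat) : code :=
  match fuel with
  | 0 => CZero
  | S fuel' =>
    let (t, r) := unpair n in
    match t with
    | 0 => CZero
    | 1 => CSucc
    | 2 => CId
    | 3 => CFst
    | 4 => CSnd
    | 5 => let (a, b) := unpair r in CPair (decode_aux fuel' a) (decode_aux fuel' b)
    | 6 => let (a, b) := unpair r in CComp (decode_aux fuel' a) (decode_aux fuel' b)
    | 7 => let (a, b) := unpair r in CPrec (decode_aux fuel' a) (decode_aux fuel' b)
    | 8 => CMu (decode_aux fuel' r)
    | _ => CZero
    end
  end.

Definition decode (n : nat) : code := decode_aux (S n) n.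

Definition W (e : nat) (x : nat) : Prop := exists k v, eval k (decode e) x = Some v.

Definition computable (f : nat -> nat) : Prop :=
  exists c : code, forall x, exists k, eval k c x = Some (f x).

Definition enc (xs : list nat) : nat := fold_right pair 0 xs.

Definition Pi02 (R : nat -> nat -> Prop) : Prop :=
  exists p : nat -> nat, computable p /\
    forall x y, R x y <-> forall u, exists v, p (enc [x; y; u; v]) = 0.

Definition is_equiv (R : nat -> nat -> Prop) : Prop :=
  (forall x, R x x) /\ (forall x y, R x y -> R y x) /\
  (forall x y z, R x y -> R y z -> R x z).

Definition Pi02_equiv (R : nat -> nat -> Prop) : Prop := is_equiv R /\ Pi02 R.

(** E <=_c^n F : a total computable map omega^n -> omega^n, given by its n
    component functions g 0, ..., g (n-1), each computable from the encoded
    input tuple, with x_i E x_j <-> y_i F y_j for all i < j < n. *)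
Definition red_c (n : nat) (E F : nat -> nat -> Prop) : Prop :=
  exists g : nat -> nat -> nat,
    (forall j, j < n -> computable (g j)) /\
    forall xs : list nat, length xs = n ->
      forall i j, i < j -> j < n ->
        (E (nth i xs 0) (nth j xs 0) <-> F (g i (enc xs)) (g j (enc xs))).

Inductive extnat : Type := NegInf | Fin (m : nat) | PosInf.

Definition has_max (A : nat -> Prop) (v : extnat) : Prop :=
  match v with
  | NegInf => forall x, ~ A x
  | Fin m => A m /\ forall x, A x -> x <= m
  | PosInf => forall n, exists x, n <= x /\ A x
  end.

(** i E^ce_max j  iff  max(W_i) = max(W_j). *)
Definition Emax (i j : nat) : Prop :=
  forall v : extnat, has_max (W i) v <-> has_max (W j) v.

(* Main.v *)
From Stdlib Require Import Arith Bool List Lia Cantor Classical.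
Require Import Defs.
Import ListNotations.

(** An equivalence relation on three points has at most one non-singleton class. Hence,
    given [x0, x1, x2], let the set [A_i] grow whenever some [j <> i] meets one more of the
    Pi02 requirements for [R x_i x_j]: the points of the large class get infinite sets, and
    a singleton point gets a finite set, whose maximum is kept distinct from the others by
    a tag [i].

    On four points two large classes may coexist, and this can be diagonalized. Against a
    candidate reduction [g], keep the pairs [{x0, x1}] and [{x2, x3}] unrelated to each
    other, and inside each pair declare the two points equivalent unless [g] gives them sets
    with the same finite maximum, a Pi02 condition. If [g] is correct, all four sets
    are then infinite, although [x0] and [x2] are not equivalent. The relation is Pi02 because
    halting of codes can be simulated by a computable step function on encoded machine
    states. *)

(** * Cantor projections and the big-step semantics of codes *)

#[local] Arguments pair : simpl never.

Definition pfst (n : nat) : nat := fst (unpair n).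
Definition psnd (n : nat) : nat := snd (unpair n).

#[local] Arguments pfst : simpl never.
#[local] Arguments psnd : simpl never.

Lemma pfst_pair x y : pfst (pair x y) = x.
Proof. unfold pfst, unpair, pair. now rewrite cancel_of_to. Qed.

Lemma psnd_pair x y : psnd (pair x y) = y.
Proof. unfold psnd, unpair, pair. now rewrite cancel_of_to. Qed.

Lemma pair_proj n : pair (pfst n) (psnd n) = n.
Proof.
  unfold pfst, psnd, unpair, pair.
  rewrite <- surjective_pairing. apply cancel_to_of.
Qed.

Lemma pair_ge x y : x + y <= pair x y.
Proof. pose proof (to_nat_non_decreasing x y). unfold pair. lia. Qed.

Lemma proj_le n : pfst n + psnd n <= n.
Proof. rewrite <- (pair_proj n) at 3. apply pair_ge. Qed.

Definition ev (c : code) (x v : nat) : Prop := exists k, eval k c x = Some v.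

(** A named copy of the anonymous loop in [eval], with the evaluators of the subcodes abstracted, so
    that inductions on it can be stated. [mu_loop] serves the same purpose, and [eval_prec] and
    [eval_mu] hold by conversion. *)
Definition prec_loop (F G : nat -> option nat) (y : nat) : nat -> option nat :=
  fix loop (m : nat) : option nat :=
    match m with
    | 0 => F y
    | S m' => obind (loop m') (fun r => G (pair y (pair m' r)))
    end.

Definition mu_loop (F : nat -> option nat) (x : nat) : nat -> nat -> option nat :=
  fix search (i fuel : nat) : option nat :=
    match fuel with
    | 0 => None
    | S fuel' =>
      match F (pair x i) with
      | Some 0 => Some i
      | Some (S _) => search (S i) fuel'
      | None => None
      end
    end.

Lemma eval_prec k f g x :
  eval (S k) (CPrec f g) x = prec_loop (eval k f) (eval k g) (pfst x) (psnd x).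
Proof. reflexivity. Qed.

Lemma eval_mu k f x : eval (S k) (CMu f) x = mu_loop (eval k f) x 0 (S k).
Proof. reflexivity. Qed.

Lemma obind_some o k v : obind o k = Some v <-> exists a, o = Some a /\ k a = Some v.
Proof.
  destruct o as [a|]; simpl; split.
  - intros H. now exists a.
  - intros (b & Hb & H). injection Hb as ->. exact H.
  - discriminate.
  - intros (b & Hb & _). discriminate.
Qed.

Lemma prec_loop_mono (F F' G G' : nat -> option nat) y :
  (forall x v, F x = Some v -> F' x = Some v) ->
  (forall x v, G x = Some v -> G' x = Some v) ->
  forall m v, prec_loop F G y m = Some v -> prec_loop F' G' y m = Some v.
Proof.
  intros HF HG. induction m as [|m IH]; simpl; intros v; [apply HF|].
  rewrite !obind_some. intros (a & Ha & Hv). exists a. auto.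
Qed.

(** The start [i] is arbitrary because each recursive call moves it. The fuel [n] survives only as
    the upper end of the search window. *)
Lemma mu_loop_spec (F : nat -> option nat) x v :
  forall n i, mu_loop F x i n = Some v <->
    i <= v < i + n /\ F (pair x v) = Some 0 /\
    forall j, i <= j < v -> exists w, F (pair x j) = Some (S w).
Proof.
  induction n as [|n IH]; simpl; intros i.
  - split; [discriminate | lia].
  - destruct (F (pair x i)) as [[|w]|] eqn:E.
    + split.
      * intros H; injection H as <-. repeat split; try lia; auto.
      * intros (Hv & H0 & Hj). destruct (Nat.eq_dec i v) as [->|Hne]; [easy|].
        destruct (Hj i) as [w Hw]; [lia | congruence].
    + rewrite IH. split.
      * intros (Hv & H0 & Hj). repeat split; try lia; auto.
        intros j Hij. destruct (Nat.eq_dec i j) as [<-|]; [eauto|apply Hj; lia].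
      * intros (Hv & H0 & Hj). destruct (Nat.eq_dec i v) as [->|Hne]; [congruence|].
        repeat split; try lia; auto. intros j Hij. apply Hj; lia.
    + split; [discriminate|]. intros (Hv & H0 & Hj).
      destruct (Nat.eq_dec i v) as [->|Hne]; [congruence|].
      destruct (Hj i) as [w Hw]; [lia | congruence].
Qed.

Lemma eval_S k : forall c x v, eval k c x = Some v -> eval (S k) c x = Some v.
Proof.
  induction k as [|k IH]; intros c x v H; [discriminate|].
  destruct c; try exact H.
  (* [change] unfolds one level of [eval] only; [simpl] would also unfold the inner [eval (S k)],
     which the induction hypothesis has to match. *)
  - simpl in H. change (obind (eval (S k) c1 x) (fun a => obind (eval (S k) c2 x)
      (fun b => Some (pair a b))) = Some v).
    rewrite obind_some in *. destruct H as (a & Ha & H). exists a. split; auto.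
    rewrite obind_some in *. destruct H as (b & Hb & H). exists b. auto.
  - simpl in H. change (obind (eval (S k) c2 x) (fun a => eval (S k) c1 a) = Some v).
    rewrite obind_some in *. destruct H as (a & Ha & H). exists a. auto.
  - rewrite eval_prec in *. revert H. apply prec_loop_mono; auto.
  - rewrite eval_mu in *. rewrite mu_loop_spec in *.
    destruct H as (Hv & H0 & Hj). repeat split; try lia; auto.
    intros j Hij. destruct (Hj j Hij) as [w Hw]. eauto.
Qed.

Lemma eval_mono k k' c x v : k <= k' -> eval k c x = Some v -> eval k' c x = Some v.
Proof. induction 1; auto using eval_S. Qed.

Lemma ev_functional c x v v' : ev c x v -> ev c x v' -> v = v'.
Proof.
  intros [k H] [k' H'].
  apply (eval_mono _ (k + k')) in H; [|lia].
  apply (eval_mono _ (k + k')) in H'; [|lia]. congruence.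
Qed.

Lemma ev_pair f g x v :
  ev (CPair f g) x v <-> exists a b, ev f x a /\ ev g x b /\ v = pair a b.
Proof.
  split.
  - intros [[|k] H]; [discriminate|]. simpl in H.
    rewrite obind_some in H. destruct H as (a & Ha & H).
    rewrite obind_some in H. destruct H as (b & Hb & H).
    injection H as <-. exists a, b. repeat split; [exists k | exists k]; auto.
  - intros (a & b & [k Ha] & [k' Hb] & ->). exists (S (k + k')). simpl.
    rewrite (eval_mono k (k + k') f x a), (eval_mono k' (k + k') g x b); auto; lia.
Qed.

Lemma ev_comp f g x v : ev (CComp f g) x v <-> exists a, ev g x a /\ ev f a v.
Proof.
  split.
  - intros [[|k] H]; [discriminate|]. simpl in H.
    rewrite obind_some in H. destruct H as (a & Ha & H).
    exists a. split; exists k; auto.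
  - intros (a & [k Ha] & [k' Hb]). exists (S (k + k')). simpl.
    rewrite (eval_mono k (k + k') g x a); auto; [simpl|lia].
    apply (eval_mono k'); auto; lia.
Qed.

Lemma ev_prec_0 f g x v : psnd x = 0 -> ev (CPrec f g) x v <-> ev f (pfst x) v.
Proof.
  intros Hx. split.
  - intros [[|k] H]; [discriminate|]. rewrite eval_prec, Hx in H. now exists k.
  - intros [k H]. exists (S k). now rewrite eval_prec, Hx.
Qed.

Lemma ev_prec_S f g x m v : psnd x = S m ->
  ev (CPrec f g) x v <->
  exists r, ev (CPrec f g) (pair (pfst x) m) r /\ ev g (pair (pfst x) (pair m r)) v.
Proof.
  intros Hx. split.
  - intros [[|k] H]; [discriminate|]. rewrite eval_prec, Hx in H.
    simpl in H. rewrite obind_some in H. destruct H as (r & Hr & H).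
    exists r. split; [|now exists k]. exists (S k).
    now rewrite eval_prec, pfst_pair, psnd_pair.
  - intros (r & [[|k] Hr] & [k' H]); [discriminate|].
    exists (S (k + k')). rewrite eval_prec, Hx. simpl. rewrite obind_some. exists r.
    apply (eval_mono _ (S (k + k'))) in Hr; [|lia].
    rewrite eval_prec, pfst_pair, psnd_pair in Hr.
    split; [exact Hr|]. apply (eval_mono k'); auto; lia.
Qed.

Lemma ev_mu f x v : ev (CMu f) x v <->
  ev f (pair x v) 0 /\ forall i, i < v -> exists w, ev f (pair x i) (S w).
Proof.
  split.
  - intros [[|k] H]; [discriminate|]. rewrite eval_mu, mu_loop_spec in H.
    destruct H as (_ & H0 & H). split; [now exists k|].
    intros i Hi. destruct (H i) as [w Hw]; [lia|]. exists w. now exists k.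
  - intros ([k H0] & H).
    (* One fuel serves all of the finitely many failed trials below [v]. *)
    assert (B : exists k', forall i, i < v -> exists w, eval k' f (pair x i) = Some (S w)).
    { clear H0 k. induction v as [|v IH].
      - exists 0. intros i Hi. lia.
      - destruct IH as [k' Hk']; [intros; apply H; lia|].
        destruct (H v) as [w [k Hw]]; [lia|]. exists (k + k').
        intros i Hi. destruct (Nat.eq_dec i v) as [->|].
        + exists w. apply (eval_mono k); auto; lia.
        + destruct (Hk' i) as [w' Hw']; [lia|].
          exists w'. apply (eval_mono k'); auto; lia. }
    (* The summand [v] pays for the iterations of the search, whose length is bounded by the same
       fuel. *)
    destruct B as [k' Hk']. exists (S (k + k' + v)).
    rewrite eval_mu, mu_loop_spec. repeat split; try lia.
    + apply (eval_mono k); auto; lia.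
    + intros j Hj. destruct (Hk' j) as [w Hw]; [lia|].
      exists w. apply (eval_mono k'); auto; lia.
Qed.

Lemma ev_atom c x v w : eval 1 c x = Some v -> ev c x w <-> w = v.
Proof.
  intros H. split.
  - intros Hw. eapply ev_functional; [exact Hw | now exists 1].
  - intros ->. now exists 1.
Qed.

Lemma ev_zero x v : ev CZero x v <-> v = 0.
Proof. now apply ev_atom. Qed.

Lemma ev_succ x v : ev CSucc x v <-> v = S x.
Proof. now apply ev_atom. Qed.

Lemma ev_id x v : ev CId x v <-> v = x.
Proof. now apply ev_atom. Qed.

Lemma ev_fst x v : ev CFst x v <-> v = pfst x.
Proof. now apply ev_atom. Qed.

Lemma ev_snd x v : ev CSnd x v <-> v = psnd x.
Proof. now apply ev_atom. Qed.

(** * Closure properties of computable functions *)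

Lemma computable_ext f g : (forall x, f x = g x) -> computable f -> computable g.
Proof. intros E [c Hc]. exists c. intros x. rewrite <- E. apply Hc. Qed.

Lemma computable_id : computable (fun x => x).
Proof. exists CId. intros x. now apply ev_id. Qed.

Lemma computable_comp f g :
  computable f -> computable g -> computable (fun x => f (g x)).
Proof.
  intros [cf Hf] [cg Hg]. exists (CComp cf cg). intros x. apply ev_comp.
  exists (g x). split; [apply Hg | apply Hf].
Qed.

Lemma computable_pair f g :
  computable f -> computable g -> computable (fun x => pair (f x) (g x)).
Proof.
  intros [cf Hf] [cg Hg]. exists (CPair cf cg). intros x. apply ev_pair.
  exists (f x), (g x). split; [apply Hf | split; [apply Hg | reflexivity]].
Qed.

Lemma computable_S f : computable f -> computable (fun x => S (f x)).
Proof.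
  apply (computable_comp S). exists CSucc. intros x. now apply ev_succ.
Qed.

Lemma computable_pfst f : computable f -> computable (fun x => pfst (f x)).
Proof.
  apply (computable_comp pfst). exists CFst. intros x. now apply ev_fst.
Qed.

Lemma computable_psnd f : computable f -> computable (fun x => psnd (f x)).
Proof.
  apply (computable_comp psnd). exists CSnd. intros x. now apply ev_snd.
Qed.

Lemma computable_const n : computable (fun _ => n).
Proof.
  induction n as [|n IH]; [|now apply computable_S].
  exists CZero. intros x. now apply ev_zero.
Qed.

(** Running [CPrec] on the pair of [x] and [g x] keeps the whole input [x] as parameter of the
    recursion, so both the base case and the step may depend on it. *)
Lemma computable_rec f g h :
  computable f -> computable g ->
  computable (fun z => h (pfst z) (pfst (psnd z)) (psnd (psnd z))) ->
  computable (fun x => nat_rect (fun _ => nat) (f x) (h x) (g x)).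
Proof.
  intros [cf Hf] [cg Hg] [ch Hh].
  exists (CComp (CPrec cf ch) (CPair CId cg)). intros x. apply ev_comp.
  exists (pair x (g x)). split.
  - apply ev_pair. exists x, (g x). split; [now apply ev_id | split; [apply Hg | reflexivity]].
  - generalize (g x) as m. induction m as [|m IH].
    + apply ev_prec_0; [apply psnd_pair|]. rewrite pfst_pair. apply Hf.
    + apply (ev_prec_S _ _ _ m); [apply psnd_pair|]. rewrite pfst_pair.
      eexists. split; [exact IH|].
      destruct (Hh (pair x (pair m (nat_rect (fun _ => nat) (f x) (h x) m)))) as [k Hk].
      exists k. rewrite !psnd_pair, !pfst_pair, ?psnd_pair in Hk. exact Hk.
Qed.

(** Truth is coded by [0], in agreement with the success value of [CMu] and of the matrix in
    [Pi02]. *)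
Definition computable_pred (b : nat -> bool) : Prop :=
  computable (fun x => if b x then 0 else 1).

Lemma computable_eq0 f : computable f -> computable_pred (fun x => f x =? 0).
Proof.
  intros Hf. apply (computable_ext
    (fun x => nat_rect (fun _ => nat) 0 (fun _ _ => 1) (f x))).
  - intros x. now destruct (f x).
  - apply (computable_rec (fun _ => 0) f (fun _ _ _ => 1)); auto using computable_const.
Qed.

(** A conditional is a recursion of length [0] or [1] whose step discards the previous value. *)
Lemma computable_if b f g :
  computable_pred b -> computable f -> computable g ->
  computable (fun x => if b x then f x else g x).
Proof.
  intros Hb Hf Hg. apply (computable_ext
    (fun x => nat_rect (fun _ => nat) (f x) (fun _ _ => g x) (if b x then 0 else 1))).
  - intros x. now destruct (b x).
  - apply (computable_rec f _ (fun x _ _ => g x)); auto.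
    apply (computable_comp g); auto using computable_pfst, computable_id.
Qed.

Lemma computable_predecessor f : computable f -> computable (fun x => pred (f x)).
Proof.
  intros Hf. apply (computable_ext
    (fun x => nat_rect (fun _ => nat) 0 (fun m _ => m) (f x))).
  - intros x. now destruct (f x).
  - apply (computable_rec (fun _ => 0) f (fun _ m _ => m));
      auto using computable_const, computable_psnd, computable_pfst, computable_id.
Qed.

Lemma computable_add f g :
  computable f -> computable g -> computable (fun x => f x + g x).
Proof.
  intros Hf Hg. apply (computable_ext
    (fun x => nat_rect (fun _ => nat) (g x) (fun _ r => S r) (f x))).
  - intros x. induction (f x); simpl; congruence.
  - apply (computable_rec g f (fun _ _ r => S r));
      auto using computable_S, computable_psnd, computable_id.
Qed.

Lemma computable_sub f g :
  computable f -> computable g -> computable (fun x => f x - g x).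
Proof.
  intros Hf Hg. apply (computable_ext
    (fun x => nat_rect (fun _ => nat) (f x) (fun _ r => pred r) (g x))).
  - intros x. induction (g x) as [|m IH]; simpl; [lia|]. rewrite IH. lia.
  - apply (computable_rec f g (fun _ _ r => pred r));
      auto using computable_predecessor, computable_psnd, computable_id.
Qed.

Lemma computable_iter step f g :
  computable step -> computable f -> computable g ->
  computable (fun x => Nat.iter (f x) step (g x)).
Proof.
  intros Hs Hf Hg. apply (computable_rec g f (fun _ _ r => step r)); auto.
  apply (computable_comp step); auto using computable_psnd, computable_id.
Qed.

Lemma computable_eqb f g :
  computable f -> computable g -> computable_pred (fun x => f x =? g x).
Proof.
  intros Hf Hg. apply (computable_ext
    (fun x => if (f x - g x) + (g x - f x) =? 0 then 0 else 1)).
  - intros x. destruct (Nat.eqb_spec (f x) (g x)), (Nat.eqb_spec (f x - g x + (g x - f x)) 0);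
      auto; lia.
  - apply computable_eq0, computable_add; now apply computable_sub.
Qed.

Lemma computable_negb b : computable_pred b -> computable_pred (fun x => negb (b x)).
Proof.
  intros Hb. apply (computable_ext (fun x => if b x then 1 else 0)).
  - intros x. now destruct (b x).
  - apply computable_if; auto using computable_const.
Qed.

Lemma computable_andb b b' :
  computable_pred b -> computable_pred b' -> computable_pred (fun x => b x && b' x).
Proof.
  intros Hb Hb'. apply (computable_ext
    (fun x => if b x then if b' x then 0 else 1 else 1)).
  - intros x. now destruct (b x).
  - apply computable_if; auto using computable_const.
Qed.

Lemma computable_orb b b' :
  computable_pred b -> computable_pred b' -> computable_pred (fun x => b x || b' x).
Proof.
  intros Hb Hb'. apply (computable_ext
    (fun x => if b x then 0 else if b' x then 0 else 1)).
  - intros x. now destruct (b x).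
  - apply computable_if; auto using computable_const.
Qed.

Definition bforall (n : nat) (b : nat -> bool) : bool :=
  nat_rect (fun _ => bool) true (fun m r => r && b m) n.

Definition bexists (n : nat) (b : nat -> bool) : bool :=
  negb (bforall n (fun m => negb (b m))).

Lemma bforall_spec n b : bforall n b = true <-> forall m, m < n -> b m = true.
Proof.
  induction n as [|n IH]; simpl.
  - split; [intros _ m Hm; lia | auto].
  - rewrite andb_true_iff. unfold bforall in IH. rewrite IH. split.
    + intros [H Hn] m Hm. destruct (Nat.eq_dec m n) as [->|]; auto. apply H; lia.
    + intros H. split; [intros m Hm|]; apply H; lia.
Qed.

Lemma bexists_spec n b : bexists n b = true <-> exists m, m < n /\ b m = true.
Proof.
  unfold bexists. rewrite negb_true_iff, <- not_true_iff_false, bforall_spec. split.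
  - intros H. apply not_all_ex_not in H. destruct H as [m H]. exists m.
    apply imply_to_and in H. destruct H as [Hm H]. split; auto.
    now destruct (b m).
  - intros (m & Hm & Hb) H. specialize (H m Hm). rewrite Hb in H. discriminate.
Qed.

Lemma computable_bforall g b :
  computable g -> computable_pred (fun z => b (pfst z) (psnd z)) ->
  computable_pred (fun x => bforall (g x) (b x)).
Proof.
  intros Hg Hb. apply (computable_ext
    (fun x => nat_rect (fun _ => nat) 0
      (fun m r => if r =? 0 then if b x m then 0 else 1 else 1) (g x))).
  - intros x. induction (g x) as [|m IH]; simpl; auto.
    rewrite IH. unfold bforall. now destruct (nat_rect (fun _ => bool) true _ m).
  - apply (computable_rec (fun _ => 0) g
      (fun x m r => if r =? 0 then if b x m then 0 else 1 else 1));
      auto using computable_const.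
    apply computable_if; [apply computable_eq0 | | apply computable_const];
      auto using computable_psnd, computable_id.
    (* The recursion passes [x], [m] and the accumulated value; the hypothesis on [b] expects only
       the pair of [x] and [m]. *)
    apply (computable_ext (fun z => (fun y => if b (pfst y) (psnd y) then 0 else 1)
      (pair (pfst z) (pfst (psnd z))))).
    + intros z. now rewrite pfst_pair, psnd_pair.
    + apply (computable_comp (fun y => if b (pfst y) (psnd y) then 0 else 1)); [exact Hb|].
      auto using computable_pair, computable_pfst, computable_psnd, computable_id.
Qed.

Lemma computable_bexists g b :
  computable g -> computable_pred (fun z => b (pfst z) (psnd z)) ->
  computable_pred (fun x => bexists (g x) (b x)).
Proof.
  intros Hg Hb. apply computable_negb.
  apply (computable_bforall g (fun x m => negb (b x m))); auto.
  now apply (computable_negb (fun z => b (pfst z) (psnd z))).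
Qed.

Ltac computability :=
  repeat (cbv beta; lazymatch goal with
  | H : computable ?f |- computable ?f => exact H
  | |- computable (fun x => x) => apply computable_id
  | |- computable (fun _ => ?n) => apply (computable_const n)
  | |- computable (fun x => pair (@?f x) (@?g x)) => apply (computable_pair f g)
  | |- computable (fun x => S (@?f x)) => apply (computable_S f)
  | |- computable (fun x => pred (@?f x)) => apply (computable_predecessor f)
  | |- computable (fun x => pfst (@?f x)) => apply (computable_pfst f)
  | |- computable (fun x => psnd (@?f x)) => apply (computable_psnd f)
  | |- computable (fun x => @?f x + @?g x) => apply (computable_add f g)
  | |- computable (fun x => if @?b x then @?f x else @?g x) => apply (computable_if b f g)
  | |- computable_pred (fun x => @?f x =? 0) => apply (computable_eq0 f)
  | |- computable_pred (fun x => @?f x =? @?g x) => apply (computable_eqb f g)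
  | |- computable_pred (fun x => negb (@?f x)) => apply (computable_negb f)
  | |- computable_pred (fun x => (@?f x) && (@?g x)) => apply (computable_andb f g)
  | |- computable_pred (fun x => (@?f x) || (@?g x)) => apply (computable_orb f g)
  | |- computable_pred (fun x => bforall (@?f x) (@?g x)) => apply (computable_bforall f g)
  | |- computable_pred (fun x => bexists (@?f x) (@?g x)) => apply (computable_bexists f g)
  | H : computable ?p |- computable (fun x => ?p (@?f x)) => apply (computable_comp p f H)
  end).

(** * Indices of codes and the parameter theorem *)

Fixpoint encode (c : code) : nat :=
  match c with
  | CZero => pair 0 0
  | CSucc => pair 1 0
  | CId => pair 2 0
  | CFst => pair 3 0
  | CSnd => pair 4 0
  | CPair f g => pair 5 (pair (encode f) (encode g))
  | CComp f g => pair 6 (pair (encode f) (encode g))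
  | CPrec f g => pair 7 (pair (encode f) (encode g))
  | CMu f => pair 8 (encode f)
  end.

Lemma decode_aux_S fuel n : decode_aux (S fuel) n =
  match pfst n with
  | 0 => CZero
  | 1 => CSucc
  | 2 => CId
  | 3 => CFst
  | 4 => CSnd
  | 5 => CPair (decode_aux fuel (pfst (psnd n))) (decode_aux fuel (psnd (psnd n)))
  | 6 => CComp (decode_aux fuel (pfst (psnd n))) (decode_aux fuel (psnd (psnd n)))
  | 7 => CPrec (decode_aux fuel (pfst (psnd n))) (decode_aux fuel (psnd (psnd n)))
  | 8 => CMu (decode_aux fuel (psnd n))
  | _ => CZero
  end.
Proof.
  unfold pfst, psnd. simpl. destruct (unpair n) as [t r]. simpl.
  destruct (unpair r) as [a b]. reflexivity.
Qed.

(** Recursive calls occur only under tags at least 5, where [proj_le] makes their arguments strictly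
    smaller than [n]. This frees [decode] from its fuel in [decode_eq]. *)
Lemma decode_aux_fuel fuel : forall fuel' n,
  n < fuel -> n < fuel' -> decode_aux fuel n = decode_aux fuel' n.
Proof.
  induction fuel as [|fuel IH]; intros [|fuel'] n Hn Hn'; try lia.
  rewrite !decode_aux_S.
  pose proof (proj_le n) as B. pose proof (proj_le (psnd n)) as B'.
  destruct (pfst n) as [|[|[|[|[|[|[|[|[|t]]]]]]]]]; try reflexivity; f_equal; apply IH; lia.
Qed.

Lemma decode_eq n : decode n =
  match pfst n with
  | 0 => CZero
  | 1 => CSucc
  | 2 => CId
  | 3 => CFst
  | 4 => CSnd
  | 5 => CPair (decode (pfst (psnd n))) (decode (psnd (psnd n)))
  | 6 => CComp (decode (pfst (psnd n))) (decode (psnd (psnd n)))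
  | 7 => CPrec (decode (pfst (psnd n))) (decode (psnd (psnd n)))
  | 8 => CMu (decode (psnd n))
  | _ => CZero
  end.
Proof.
  unfold decode. rewrite decode_aux_S.
  pose proof (proj_le n) as B. pose proof (proj_le (psnd n)) as B'.
  destruct (pfst n) as [|[|[|[|[|[|[|[|[|t]]]]]]]]]; try reflexivity; f_equal;
    apply decode_aux_fuel; lia.
Qed.

Lemma decode_encode c : decode (encode c) = c.
Proof.
  induction c; simpl; rewrite decode_eq, ?psnd_pair, ?pfst_pair, ?psnd_pair; congruence.
Qed.

Lemma W_ev e x : W e x <-> exists v, ev (decode e) x v.
Proof. split; intros (a & b & H); exists b, a; exact H. Qed.

Fixpoint const_code (n : nat) : code :=
  match n with
  | 0 => CZero
  | S m => CComp CSucc (const_code m)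
  end.

Lemma ev_const_code n x : ev (const_code n) x n.
Proof.
  induction n as [|n IH]; simpl; [now apply ev_zero|].
  apply ev_comp. exists n. split; [exact IH | now apply ev_succ].
Qed.

Lemma computable_encode_const : computable (fun n => encode (const_code n)).
Proof.
  apply (computable_ext (fun n => nat_rect (fun _ => nat) (encode CZero)
    (fun _ r => pair 6 (pair (encode CSucc) r)) n)).
  - induction x as [|x IH]; simpl; [reflexivity | now rewrite <- IH].
  - apply (computable_rec _ _ (fun _ _ r => pair 6 (pair (encode CSucc) r))); computability.
Qed.

(** The parameter [a] is hard-wired by [const_code a], whose index is computable from [a], into an
    unbounded search for a zero of [f]. Since [f] is total, the search halts exactly when a zero
    exists. *)
Lemma parameter_theorem f : computable f ->
  exists s, computable s /\
    forall a z, W (s a) z <-> exists n, f (pair (pair a z) n) = 0.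
Proof.
  intros [cf Hf].
  exists (fun a => encode (CMu (CComp cf (CPair (CPair (const_code a) CFst) CSnd)))).
  split.
  - pose proof computable_encode_const. cbn [encode]. computability.
  - intros a z. rewrite W_ev, decode_encode.
    assert (E : forall n, ev (CComp cf (CPair (CPair (const_code a) CFst) CSnd))
                  (pair z n) (f (pair (pair a z) n))).
    { intros n. apply ev_comp. exists (pair (pair a z) n). split; [|apply Hf].
      apply ev_pair. exists (pair a z), n. repeat split.
      - apply ev_pair. exists a, z. repeat split; [apply ev_const_code|].
        apply ev_fst. now rewrite pfst_pair.
      - apply ev_snd. now rewrite psnd_pair. }
    split.
    + intros [v Hv]. apply ev_mu in Hv. destruct Hv as [H0 _]. exists v.
      eapply ev_functional; eauto.
    + intros [n Hn].
      (* [CMu] returns the least zero, so an arbitrary zero [n] has to be replaced by the least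
         one. *)
      destruct (dec_inh_nat_subset_has_unique_least_element
        (fun n => f (pair (pair a z) n) = 0)) as (v & [Hv Hmin] & _).
      * intros m. destruct (Nat.eq_dec (f (pair (pair a z) m)) 0); auto.
      * now exists n.
      * exists v. apply ev_mu. split; [now rewrite <- Hv|].
        intros i Hi. exists (pred (f (pair (pair a z) i))).
        destruct (f (pair (pair a z) i)) as [|w] eqn:Ew; [apply Hmin in Ew; lia|].
        specialize (E i). now rewrite Ew in E.
Qed.

(** * Maxima *)

Definition same_max (A B : nat -> Prop) : Prop := forall v, has_max A v <-> has_max B v.

Lemma has_max_ext A B : (forall x, A x <-> B x) -> same_max A B.
Proof.
  intros E [|m|]; simpl.
  - split; intros H x Hx; apply (H x), E, Hx.
  - rewrite E. split; intros [H H']; split; auto; intros x Hx; apply H', E, Hx.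
  - split; intros H n; destruct (H n) as (x & Hn & Hx); exists x; split; auto; now apply E.
Qed.

Lemma has_max_unique A v v' : has_max A v -> has_max A v' -> v = v'.
Proof.
  assert (NP : has_max A NegInf -> has_max A PosInf -> False).
  { intros H H'. destruct (H' 0) as (x & _ & Hx). exact (H x Hx). }
  assert (FP : forall m, has_max A (Fin m) -> has_max A PosInf -> False).
  { intros m [_ H] H'. destruct (H' (S m)) as (x & Hm & Hx). apply H in Hx. lia. }
  assert (NF : forall m, has_max A NegInf -> has_max A (Fin m) -> False).
  { intros m H [H' _]. exact (H m H'). }
  destruct v as [|m|], v' as [|m'|]; intros H H'; auto; try (exfalso; eauto; fail).
  destruct H as [H1 H2], H' as [H1' H2'].
  f_equal. apply H2 in H1'. apply H2' in H1. lia.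
Qed.

Lemma same_max_intro A B v : has_max A v -> has_max B v -> same_max A B.
Proof.
  intros HA HB v'. split; intros H.
  - now rewrite (has_max_unique A v' v).
  - now rewrite (has_max_unique B v' v).
Qed.

Lemma bounded_has_max (A : nat -> Prop) n :
  (forall x, A x -> x < n) -> has_max A NegInf \/ exists m, has_max A (Fin m).
Proof.
  induction n as [|n IH]; intros H.
  - left. intros x Hx. apply H in Hx. lia.
  - destruct (classic (A n)) as [Hn|Hn].
    + right. exists n. split; auto. intros x Hx. apply H in Hx. lia.
    + apply IH. intros x Hx. destruct (Nat.eq_dec x n) as [->|]; [easy|].
      apply H in Hx. lia.
Qed.

Lemma has_max_total (A : nat -> Prop) : exists v, has_max A v.
Proof.
  destruct (classic (has_max A PosInf)) as [H|H]; [eauto|].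
  apply not_all_ex_not in H. destruct H as [n H].
  destruct (bounded_has_max A n) as [H'|[m Hm]]; eauto.
  intros x Hx. destruct (Nat.lt_ge_cases x n); auto. exfalso. eauto.
Qed.

(** * Ternary completeness *)

(* The elements carry the tag [i], so sets with different tags never share a finite
   maximum; [psnd z] both chooses which of [b], [c] is compared with [a] and bounds
   the number of requirements to be met. *)
Definition tagged_set (p : nat -> nat) (i a b c z : nat) : Prop :=
  pfst z = i /\
  forall u, u < psnd z ->
    exists v, p (enc [a; if pfst (psnd z) =? 0 then b else c; u; v]) = 0.

(** Membership is c.e. because the universal quantifier over [u] is bounded: a common bound [n] on
    the witnesses [v] turns it into a decidable condition on [n]. *)
Lemma tagged_set_index p i fa fb fc :
  computable p -> computable fa -> computable fb -> computable fc ->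
  exists s, computable s /\
    forall a z, W (s a) z <-> tagged_set p i (fa a) (fb a) (fc a) z.
Proof.
  intros Hp Ha Hb Hc.
  (* Here [t] codes the parameter, the element [z] and the bound [n], as [pair (pair a z) n]. *)
  destruct (parameter_theorem (fun t =>
    if (pfst (psnd (pfst t)) =? i) &&
       bforall (psnd (psnd (pfst t))) (fun u => bexists (psnd t) (fun v =>
         p (pair (fa (pfst (pfst t)))
             (pair (if pfst (psnd (psnd (pfst t))) =? 0
                    then fb (pfst (pfst t)) else fc (pfst (pfst t)))
               (pair u (pair v 0)))) =? 0))
    then 0 else 1)) as (s & Hs & Hspec).
  { match goal with |- computable (fun x => if @?b x then 0 else 1) =>
      change (computable_pred b) end.
    computability. }
  exists s. split; [exact Hs|]. intros a z. rewrite Hspec.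
  split.
  - intros [n Hn]. rewrite !pfst_pair, !psnd_pair in Hn.
    match type of Hn with (if ?b then _ else _) = _ => destruct b eqn:E; [|discriminate] end.
    rewrite andb_true_iff, Nat.eqb_eq, bforall_spec in E. destruct E as [E1 E2].
    split; auto. intros u Hu. specialize (E2 u Hu). rewrite bexists_spec in E2.
    destruct E2 as (v & _ & Hv). exists v. now apply Nat.eqb_eq.
  - intros [E1 E2].
    assert (B : exists n, forall u, u < psnd z -> exists v, v < n /\
      p (enc [fa a; if pfst (psnd z) =? 0 then fb a else fc a; u; v]) = 0).
    { revert E2. generalize (if pfst (psnd z) =? 0 then fb a else fc a) as d.
      intros d. induction (psnd z) as [|m IH]; intros E2.
      - exists 0. intros; lia.
      - destruct IH as [n Hn]; [intros; apply E2; lia|].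
        destruct (E2 m) as [v Hv]; [lia|]. exists (S (n + v)). intros u Hu.
        destruct (Nat.eq_dec u m) as [->|].
        + exists v. split; [lia | exact Hv].
        + destruct (Hn u) as (v' & Hv' & H); [lia|]. exists v'. split; [lia | exact H]. }
    destruct B as [n Hn]. exists n. rewrite !pfst_pair, !psnd_pair.
    match goal with |- (if ?b then _ else _) = _ => replace b with true; [reflexivity|] end.
    symmetry. rewrite andb_true_iff, Nat.eqb_eq, bforall_spec. split; auto.
    intros u Hu. apply bexists_spec. destruct (Hn u Hu) as (v & Hv & H).
    exists v. split; auto. now apply Nat.eqb_eq.
Qed.

Lemma pair_mono_r i w n : w <= n -> pair i w <= pair i n.
Proof.
  intros H. unfold pair.
  pose proof (to_nat_spec i w). pose proof (to_nat_spec i n). nia.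
Qed.

(** If both relations fail, say at requirements [ub] and [uc], then an element whose second
    projection exceeds both violates the one it selects. If one holds, the selector 0 or 1 gives
    arbitrarily large elements. *)
Lemma tagged_set_infinite R p i a b c :
  (forall x y, R x y <-> forall u, exists v, p (enc [x; y; u; v]) = 0) ->
  has_max (tagged_set p i a b c) PosInf <-> R a b \/ R a c.
Proof.
  intros HR. split.
  - intros H. apply NNPP. intros N. apply not_or_and in N. destruct N as [Nb Nc].
    rewrite HR in Nb, Nc.
    apply not_all_ex_not in Nb. destruct Nb as [ub Hb].
    apply not_all_ex_not in Nc. destruct Nc as [uc Hc].
    (* With the tag fixed, a code above [pair i (ub + uc)] must have its second projection above
       [ub + uc]. *)
    destruct (H (S (pair i (ub + uc)))) as (z & Hz & Hi & Hw).
    assert (B : ub + uc < psnd z).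
    { destruct (Nat.lt_ge_cases (ub + uc) (psnd z)) as [|L]; auto.
      apply (pair_mono_r i) in L. rewrite <- Hi, pair_proj in L. rewrite Hi in L. lia. }
    destruct (pfst (psnd z) =? 0); [apply Hb | apply Hc]; apply Hw; lia.
  - assert (G : forall t, R a (if t =? 0 then b else c) ->
                  has_max (tagged_set p i a b c) PosInf).
    { intros t H n. exists (pair i (pair t n)). split.
      - pose proof (pair_ge i (pair t n)). pose proof (pair_ge t n). lia.
      - split; [apply pfst_pair|]. rewrite psnd_pair, pfst_pair. intros u _.
        now apply HR. }
    intros [H|H]; [apply (G 0) | apply (G 1)]; exact H.
Qed.

(** Neither set is empty, since [pair i 0] carries no requirement, and a shared finite maximum would
    carry two different tags. Only the infinite maximum remains. *)
Lemma tagged_set_same_max p i j a b c a' b' c' : i <> j ->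
  same_max (tagged_set p i a b c) (tagged_set p j a' b' c') <->
  has_max (tagged_set p i a b c) PosInf /\ has_max (tagged_set p j a' b' c') PosInf.
Proof.
  intros Hij. split.
  - intros H. destruct (has_max_total (tagged_set p i a b c)) as [[|m|] Hm].
    + exfalso. apply (Hm (pair i 0)). split; [apply pfst_pair|].
      rewrite psnd_pair. intros; lia.
    + exfalso. apply Hij. destruct (proj1 (H _) Hm) as [[Hj _] _].
      destruct Hm as [[Hi _] _]. congruence.
    + split; auto. now apply H.
  - intros [H H']. eapply same_max_intro; eauto.
Qed.

Theorem Emax_ternary_complete R : Pi02_equiv R -> red_c 3 R Emax.
Proof.
  intros [(Hrefl & Hsym & Htrans) (p & Hp & HR)].
  set (x0 := fun t => pfst t). set (x1 := fun t => pfst (psnd t)).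
  set (x2 := fun t => pfst (psnd (psnd t))).
  assert (C0 : computable x0) by (unfold x0; computability).
  assert (C1 : computable x1) by (unfold x1; computability).
  assert (C2 : computable x2) by (unfold x2; computability).
  destruct (tagged_set_index p 0 x0 x1 x2) as (s0 & Hs0 & S0); auto.
  destruct (tagged_set_index p 1 x1 x0 x2) as (s1 & Hs1 & S1); auto.
  destruct (tagged_set_index p 2 x2 x0 x1) as (s2 & Hs2 & S2); auto.
  exists (fun j => match j with 0 => s0 | 1 => s1 | _ => s2 end). split.
  { intros [|[|j]] _; assumption. }
  intros xs Hxs.
  destruct xs as [|a [|b [|c [|]]]]; try discriminate Hxs.
  assert (E0 : x0 (enc [a; b; c]) = a) by apply pfst_pair.
  assert (E1 : x1 (enc [a; b; c]) = b).
  { unfold x1. simpl. now rewrite psnd_pair, pfst_pair. }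
  assert (E2 : x2 (enc [a; b; c]) = c).
  { unfold x2. simpl. now rewrite !psnd_pair, pfst_pair. }
  set (X := enc [a; b; c]) in *.
  specialize (S0 X). specialize (S1 X). specialize (S2 X).
  rewrite E0, E1, E2 in *.
  assert (K : forall s s' A A', (forall z, W s z <-> A z) -> (forall z, W s' z <-> A' z) ->
    Emax s s' <-> same_max A A').
  { intros s s' A A' HA HA'. apply has_max_ext in HA, HA'.
    split; intros H v; specialize (H v); specialize (HA v); specialize (HA' v); tauto. }
  intros i j Hij Hj.
  destruct j as [|[|[|j]]]; try lia; destruct i as [|[|i]]; try lia; cbn [nth].
  - rewrite (K _ _ _ _ S0 S1), tagged_set_same_max, !(tagged_set_infinite R) by auto.
    (* If both points are related only to the third one, transitivity through it relates them to
       each other; the other cases are immediate up to symmetry. The same holds for the remaining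
       two pairs. *)
    split; [|intros [[H|H] [H'|H']]]; eauto.
  - rewrite (K _ _ _ _ S0 S2), tagged_set_same_max, !(tagged_set_infinite R) by auto.
    split; [|intros [[H|H] [H'|H']]]; eauto.
  - rewrite (K _ _ _ _ S1 S2), tagged_set_same_max, !(tagged_set_infinite R) by auto.
    split; [|intros [[H|H] [H'|H']]]; eauto.
Qed.

(** * A universal abstract machine *)

(* A state [mk mode a b K] has continuation stack [K]; mode 0 evaluates the code with
   index [a] at [b], mode 1 returns the value [a] to [K], mode 2 has halted with value [a].
   The frame tags are 1 and 5 (first and second component of a pair), 2 (composition),
   3 (recursion step), 4 (minimization); any other tag is the bottom of the stack. *)
Definition mk (mode a b K : nat) : nat := pair mode (pair a (pair b K)).
Definition ret (v K : nat) : nat := mk 1 v 0 K.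
Definition push (t d K : nat) : nat := pair (pair t d) K.

(** Recursion at a positive argument reruns the same index [e] at the predecessor; its frame keeps
    the step code with that smaller argument. The frame of a minimization keeps the body with the
    current trial. *)
Definition eval_step (e x K : nat) : nat :=
  if pfst e =? 1 then ret (S x) K
  else if pfst e =? 2 then ret x K
  else if pfst e =? 3 then ret (pfst x) K
  else if pfst e =? 4 then ret (psnd x) K
  else if pfst e =? 5 then
    mk 0 (pfst (psnd e)) x (push 1 (pair (psnd (psnd e)) x) K)
  else if pfst e =? 6 then
    mk 0 (psnd (psnd e)) x (push 2 (pfst (psnd e)) K)
  else if pfst e =? 7 then
    if psnd x =? 0 then mk 0 (pfst (psnd e)) (pfst x) K
    else mk 0 e (pair (pfst x) (pred (psnd x)))
           (push 3 (pair (psnd (psnd e)) (pair (pfst x) (pred (psnd x)))) K)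
  else if pfst e =? 8 then
    mk 0 (psnd e) (pair x 0) (push 4 (pair (psnd e) (pair x 0)) K)
  else ret 0 K.

Definition return_step (v t d K : nat) : nat :=
  if t =? 1 then mk 0 (pfst d) (psnd d) (push 5 v K)
  else if t =? 2 then mk 0 d v K
  else if t =? 3 then
    mk 0 (pfst d) (pair (pfst (psnd d)) (pair (psnd (psnd d)) v)) K
  else if t =? 4 then
    if v =? 0 then ret (psnd (psnd d)) K
    else mk 0 (pfst d) (pair (pfst (psnd d)) (S (psnd (psnd d))))
           (push 4 (pair (pfst d) (pair (pfst (psnd d)) (S (psnd (psnd d))))) K)
  else if t =? 5 then ret (pair d v) K
  else mk 2 v 0 0.

Definition step (s : nat) : nat :=
  if pfst s =? 0 then
    eval_step (pfst (psnd s)) (pfst (psnd (psnd s))) (psnd (psnd (psnd s)))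
  else if pfst s =? 1 then
    return_step (pfst (psnd s)) (pfst (pfst (psnd (psnd (psnd s)))))
      (psnd (pfst (psnd (psnd (psnd s))))) (psnd (psnd (psnd (psnd s))))
  else s.

Lemma computable_step : computable step.
Proof.
  unfold step, eval_step, return_step, ret, push, mk. computability.
Qed.

Lemma step_eval e x K : step (mk 0 e x K) = eval_step e x K.
Proof.
  unfold step, mk. now rewrite !psnd_pair, !pfst_pair.
Qed.

Lemma step_ret v t d K : step (ret v (push t d K)) = return_step v t d K.
Proof.
  unfold step, ret, mk, push.
  now rewrite !psnd_pair, !pfst_pair, !psnd_pair.
Qed.

Definition reach (s s' : nat) : Prop := exists n, Nat.iter n step s = s'.

Lemma reach_refl s : reach s s.
Proof. now exists 0. Qed.

Lemma reach_step s s' : reach (step s) s' -> reach s s'.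
Proof. intros [n H]. exists (S n). now rewrite Nat.iter_succ_r. Qed.

Lemma reach_trans s s' s'' : reach s s' -> reach s' s'' -> reach s s''.
Proof. intros [n <-] [m <-]. exists (m + n). now rewrite Nat.iter_add. Qed.

(** Strong induction on the index, for every stack [K], because subcodes run under additional
    frames. *)
Lemma machine_complete e : forall x v K, ev (decode e) x v -> reach (mk 0 e x K) (ret v K).
Proof.
  induction e as [e IH] using (well_founded_induction lt_wf). intros x v K H.
  pose proof (proj_le e) as B. pose proof (proj_le (psnd e)) as B'.
  rewrite decode_eq in H.
  destruct (pfst e) as [|[|[|[|[|[|[|[|[|t]]]]]]]]] eqn:Ht.
  (* Recursion reenters [e] itself, beyond the reach of the outer hypothesis, so an inner induction
     on the recursion argument is added. *)
  8:{ assert (G : forall m y v, ev (CPrec (decode (pfst (psnd e))) (decode (psnd (psnd e))))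
        (pair y m) v -> forall K, reach (mk 0 e (pair y m) K) (ret v K)).
      { clear x v K H. induction m as [|m IHm]; intros y v H K.
        - apply ev_prec_0 in H; [|apply psnd_pair]. rewrite pfst_pair in H.
          apply reach_step. rewrite step_eval. unfold eval_step. rewrite Ht. simpl.
          rewrite psnd_pair, pfst_pair. apply IH; [lia | exact H].
        - apply (ev_prec_S _ _ _ m) in H; [|apply psnd_pair]. rewrite pfst_pair in H.
          destruct H as (r & Hr & H).
          apply reach_step. rewrite step_eval. unfold eval_step. rewrite Ht. simpl.
          rewrite psnd_pair, pfst_pair. simpl.
          eapply reach_trans; [apply IHm, Hr|].
          apply reach_step. rewrite step_ret. unfold return_step. simpl.
          rewrite !psnd_pair, !pfst_pair. apply IH; [lia | exact H]. }
      rewrite <- (pair_proj x) in *. now apply G. }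
  8:{ apply ev_mu in H. destruct H as [H0 H].
      apply reach_step. rewrite step_eval. unfold eval_step. rewrite Ht. simpl.
      (* Induction on the number [d] of trials left before the least zero [v]. *)
      assert (G : forall d i, i + d = v ->
        reach (mk 0 (psnd e) (pair x i) (push 4 (pair (psnd e) (pair x i)) K)) (ret v K)).
      { induction d as [|d IHd]; intros i Hi.
        - replace i with v by lia.
          eapply reach_trans; [apply IH; [lia | exact H0]|].
          apply reach_step. rewrite step_ret. unfold return_step. simpl.
          rewrite !psnd_pair. apply reach_refl.
        - destruct (H i) as [w Hw]; [lia|].
          eapply reach_trans; [apply IH; [lia | exact Hw]|].
          apply reach_step. rewrite step_ret. unfold return_step. simpl.
          rewrite !psnd_pair, !pfst_pair. apply IHd. lia. }
      now apply (G v 0). }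
  all: apply reach_step; rewrite step_eval; unfold eval_step; rewrite Ht; simpl.
  - apply ev_zero in H. subst. apply reach_refl.
  - apply ev_succ in H. subst. apply reach_refl.
  - apply ev_id in H. subst. apply reach_refl.
  - apply ev_fst in H. subst. apply reach_refl.
  - apply ev_snd in H. subst. apply reach_refl.
  - apply ev_pair in H. destruct H as (a & b & Ha & Hb & ->).
    eapply reach_trans; [apply IH; [lia | exact Ha]|].
    apply reach_step. rewrite step_ret. unfold return_step. simpl.
    rewrite psnd_pair, pfst_pair.
    eapply reach_trans; [apply IH; [lia | exact Hb]|].
    apply reach_step. rewrite step_ret. apply reach_refl.
  - apply ev_comp in H. destruct H as (a & Ha & H).
    eapply reach_trans; [apply IH; [lia | exact Ha]|].
    apply reach_step. rewrite step_ret. apply IH; [lia | exact H].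
  - apply ev_zero in H. subst. apply reach_refl.
Qed.

Definition halts_in (n s w : nat) : Prop :=
  pfst (Nat.iter n step s) = 2 /\ pfst (psnd (Nat.iter n step s)) = w.

Lemma halts_in_step n s w : pfst s <> 2 -> halts_in n s w ->
  exists n', n = S n' /\ halts_in n' (step s) w.
Proof.
  intros Hs [H1 H2]. destruct n as [|n]; [easy|].
  exists n. split; auto. unfold halts_in. now rewrite <- Nat.iter_succ_r.
Qed.

Lemma halts_in_eval n e x K w : halts_in n (mk 0 e x K) w ->
  exists n', n = S n' /\ halts_in n' (eval_step e x K) w.
Proof.
  intros H. rewrite <- step_eval. apply halts_in_step; auto.
  unfold mk. now rewrite pfst_pair.
Qed.

Lemma halts_in_ret n v t d K w : halts_in n (ret v (push t d K)) w ->
  exists n', n = S n' /\ halts_in n' (return_step v t d K) w.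
Proof.
  intros H. rewrite <- step_ret. apply halts_in_step; auto.
  unfold ret, mk. now rewrite pfst_pair.
Qed.

(** Induction on the length of the halting run rather than on the index. The strict drop from [n] to
    [n'] lets the hypothesis apply again to the rest of the run, and covers the calls of a recursion
    to itself. *)
Lemma machine_sound n : forall e x K w, halts_in n (mk 0 e x K) w ->
  exists v n', n' < n /\ ev (decode e) x v /\ halts_in n' (ret v K) w.
Proof.
  induction n as [n IH] using (well_founded_induction lt_wf). intros e x K w H.
  apply halts_in_eval in H. destruct H as (n1 & -> & H). unfold eval_step in H.
  rewrite decode_eq.
  destruct (pfst e) as [|[|[|[|[|[|[|[|[|t]]]]]]]]] eqn:Ht; simpl in H.
  - exists 0, n1. repeat split; auto; [now apply ev_zero | apply H | apply H].
  - exists (S x), n1. repeat split; auto; [now apply ev_succ | apply H | apply H].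
  - exists x, n1. repeat split; auto; [now apply ev_id | apply H | apply H].
  - exists (pfst x), n1. repeat split; auto; [now apply ev_fst | apply H | apply H].
  - exists (psnd x), n1. repeat split; auto; [now apply ev_snd | apply H | apply H].
  - apply IH in H; [|lia]. destruct H as (a & n2 & L2 & Ha & H).
    apply halts_in_ret in H. destruct H as (n3 & -> & H).
    unfold return_step in H. simpl in H. rewrite psnd_pair, pfst_pair in H.
    apply IH in H; [|lia]. destruct H as (b & n4 & L4 & Hb & H).
    apply halts_in_ret in H. destruct H as (n5 & -> & H).
    exists (pair a b), n5. split; [lia|]. split; [|exact H].
    apply ev_pair. eauto.
  - apply IH in H; [|lia]. destruct H as (a & n2 & L2 & Ha & H).
    apply halts_in_ret in H. destruct H as (n3 & -> & H).
    unfold return_step in H. simpl in H.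
    apply IH in H; [|lia]. destruct H as (v & n4 & L4 & Hv & H).
    exists v, n4. split; [lia|]. split; [|exact H].
    apply ev_comp. eauto.
  - destruct (psnd x) as [|m] eqn:Hm; simpl in H.
    + apply IH in H; [|lia]. destruct H as (v & n2 & L2 & Hv & H).
      exists v, n2. split; [lia|]. split; [|exact H]. now apply ev_prec_0.
    + apply IH in H; [|lia]. destruct H as (r & n2 & L2 & Hr & H).
      rewrite decode_eq, Ht in Hr.
      apply halts_in_ret in H. destruct H as (n3 & -> & H).
      unfold return_step in H. simpl in H.
      rewrite !psnd_pair, !pfst_pair, ?psnd_pair in H.
      apply IH in H; [|lia]. destruct H as (v & n4 & L4 & Hv & H).
      exists v, n4. split; [lia|]. split; [|exact H].
      apply (ev_prec_S _ _ _ m); eauto.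
  (* The trial [i] grows while the run shortens; the nonzero values below [i] are collected for
     [ev_mu]. *)
  - assert (G : forall n2 i, n2 < S n1 ->
      halts_in n2 (mk 0 (psnd e) (pair x i) (push 4 (pair (psnd e) (pair x i)) K)) w ->
      (forall j, j < i -> exists w, ev (decode (psnd e)) (pair x j) (S w)) ->
      exists v n', n' < n2 /\ ev (CMu (decode (psnd e))) x v /\ halts_in n' (ret v K) w).
    { induction n2 as [n2 IH2] using (well_founded_induction lt_wf). intros i L2 H2 Hi.
      apply IH in H2; [|lia]. destruct H2 as (v & n3 & L3 & Hv & H2).
      apply halts_in_ret in H2. destruct H2 as (n4 & -> & H2).
      unfold return_step in H2. simpl in H2. destruct v as [|v]; simpl in H2.
      - rewrite !psnd_pair in H2. exists i, n4. split; [lia|]. split; [|exact H2].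
        now apply ev_mu.
      - rewrite !psnd_pair, !pfst_pair in H2.
        apply IH2 in H2; try lia.
        + destruct H2 as (u & n5 & L5 & Hu & H2). exists u, n5. split; [lia | auto].
        + intros j Hj. destruct (Nat.eq_dec j i) as [->|]; [eauto | apply Hi; lia]. }
    apply G in H; [|lia|intros; lia].
    destruct H as (v & n2 & L2 & Hv & H). exists v, n2. split; [lia | auto].
  - exists 0, n1. repeat split; auto; [now apply ev_zero | apply H | apply H].
Qed.

(* Value [0] means that the machine is still running after [k] steps. *)
Definition sim (e x k : nat) : nat :=
  if pfst (Nat.iter k step (mk 0 e x 0)) =? 2
  then S (pfst (psnd (Nat.iter k step (mk 0 e x 0)))) else 0.

Lemma computable_sim f g h : computable f -> computable g -> computable h ->
  computable (fun x => sim (f x) (g x) (h x)).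
Proof.
  intros Hf Hg Hh.
  assert (C : computable (fun x => Nat.iter (h x) step (mk 0 (f x) (g x) 0))).
  { apply (computable_iter step h); auto using computable_step.
    unfold mk. computability. }
  unfold sim. computability.
Qed.

(** The stack [0] equals [push 0 0 0], because [pair 0 0] computes to [0]; it therefore reads as a
    bottom frame with tag 0. *)
Lemma step_empty v : step (ret v 0) = mk 2 v 0 0.
Proof. exact (step_ret v 0 0 0). Qed.

Lemma sim_sound e x k v : sim e x k = S v -> ev (decode e) x v.
Proof.
  unfold sim. destruct (Nat.eqb_spec (pfst (Nat.iter k step (mk 0 e x 0))) 2) as [E|];
    [|discriminate].
  intros H. injection H as H.
  destruct (machine_sound k e x 0 v) as (u & n & _ & Hu & Hn); [now split|].
  apply halts_in_step in Hn; [|unfold ret, mk; now rewrite pfst_pair].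
  destruct Hn as (n' & _ & Hn). rewrite step_empty in Hn.
  replace v with u; auto. destruct Hn as [_ Hn].
  (* Halted states are fixed points of [step], so the value read [n'] steps later is still [u]. *)
  revert Hn. clear. induction n' as [|n IH]; simpl.
  - unfold mk. now rewrite psnd_pair, pfst_pair.
  - assert (E : step (mk 2 u 0 0) = mk 2 u 0 0).
    { unfold step, mk. now rewrite pfst_pair. }
    rewrite <- Nat.iter_succ, Nat.iter_succ_r, E. exact IH.
Qed.

Lemma sim_complete e x v : ev (decode e) x v -> exists k, sim e x k = S v.
Proof.
  intros H. apply (machine_complete e x v 0) in H. destruct H as [n Hn].
  exists (S n). unfold sim. rewrite Nat.iter_succ, Hn, step_empty.
  unfold mk. now rewrite psnd_pair, !pfst_pair.
Qed.

Lemma sim_mono e x k k' v : k <= k' -> sim e x k = S v -> sim e x k' = S v.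
Proof.
  induction 1 as [|k' _ IH]; auto. intros H. apply IH in H. revert H.
  unfold sim. rewrite Nat.iter_succ. generalize (Nat.iter k' step (mk 0 e x 0)) as s.
  intros s. destruct (Nat.eqb_spec (pfst s) 2) as [E|]; [|discriminate].
  unfold step at 1 2. rewrite E. simpl. rewrite E. auto.
Qed.

Definition halts (e x k : nat) : bool := negb (sim e x k =? 0).

Lemma W_halts e x : W e x <-> exists k, halts e x k = true.
Proof.
  rewrite W_ev. unfold halts. split.
  - intros [v H]. apply sim_complete in H. destruct H as [k H]. exists k. now rewrite H.
  - intros [k H]. destruct (sim e x k) as [|v] eqn:E; [discriminate|].
    exists v. now apply sim_sound in E.
Qed.

Lemma halts_mono e x k k' : k <= k' -> halts e x k = true -> halts e x k' = true.
Proof.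
  unfold halts. intros L H. destruct (sim e x k) as [|v] eqn:E; [discriminate|].
  now rewrite (sim_mono _ _ _ _ _ L E).
Qed.

Lemma computable_halts f g h : computable f -> computable g -> computable h ->
  computable_pred (fun x => halts (f x) (g x) (h x)).
Proof.
  intros Hf Hg Hh. pose proof (computable_sim f g h Hf Hg Hh). unfold halts. computability.
Qed.

(** * Failure of 4-ary completeness *)

(* [n] is the strict supremum, so that [n = 0] covers two empty sets. *)
Definition same_finite_max (A B : nat -> Prop) : Prop :=
  exists n, (n = 0 \/ A (pred n) /\ B (pred n)) /\
    forall x, n <= x -> ~ A x /\ ~ B x.

Lemma same_finite_max_same_max A B : same_finite_max A B -> same_max A B.
Proof.
  intros (n & [->|[HA HB]] & H).
  - apply (same_max_intro _ _ NegInf); intros x Hx;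
      destruct (H x (Nat.le_0_l x)); auto.
  - apply (same_max_intro _ _ (Fin (pred n))); split; auto; intros x Hx;
      (destruct (Nat.lt_ge_cases x n) as [L|L]; [lia | apply H in L; tauto]).
Qed.

Lemma same_max_infinite A B :
  same_max A B -> ~ same_finite_max A B -> has_max A PosInf.
Proof.
  intros H N. destruct (has_max_total A) as [[|m|] Hm]; auto; exfalso; apply N.
  - exists 0. split; auto. intros x _. split; [apply Hm | now apply (H NegInf)].
  - pose proof (proj1 (H _) Hm) as Hm'. destruct Hm as [HA HA'], Hm' as [HB HB'].
    exists (S m). split; auto. intros x Hx.
    split; intros Hn; [apply HA' in Hn | apply HB' in Hn]; lia.
Qed.

(** The inner second component names one of two blocks belonging to [e], the outer one a point of
    that block. *)
Definition quad (e : nat) : list nat :=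
  [pair (pair e 0) 0; pair (pair e 0) 1; pair (pair e 1) 0; pair (pair e 1) 1].

(* [pfst w] packs indices [((c0, c1), (c2, c3))] of a candidate 4-ary reduction and
   [psnd w] selects the pair to diagonalize against. *)
Definition rival (w : nat) : nat :=
  if psnd w =? 0 then pfst (pfst w) else psnd (pfst w).

Definition diag (w : nat) : Prop :=
  exists y y',
    ev (decode (pfst (rival w))) (enc (quad (pfst w))) y /\
    ev (decode (psnd (rival w))) (enc (quad (pfst w))) y' /\
    ~ same_finite_max (W y) (W y').

(** If by stage [k] the number [n] looks like a common strict supremum, then [n + d], enumerated by
    stage [k2], must refute it. *)
Definition diag_test (y y' n k d k2 : nat) : bool :=
  negb ((n =? 0) || (halts y (pred n) k && halts y' (pred n) k)) ||
  (halts y (n + d) k2 || halts y' (n + d) k2).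

Lemma diag_test_spec y y' :
  ~ same_finite_max (W y) (W y') <->
  forall n k, exists d k2, diag_test y y' n k d k2 = true.
Proof.
  unfold diag_test. split.
  - intros N n k.
    destruct ((n =? 0) || (halts y (pred n) k && halts y' (pred n) k)) eqn:E;
      [simpl | now exists 0, 0].
    apply NNPP. intros Nd. apply N. exists n. split.
    + apply orb_true_iff in E. rewrite andb_true_iff, Nat.eqb_eq in E.
      destruct E as [E|[E E']]; auto. right. rewrite !W_halts. eauto.
    + intros x Hx. rewrite !W_halts.
      split; intros [k2 Hk]; apply Nd; exists (x - n), k2;
        replace (n + (x - n)) with x by lia; rewrite Hk; auto using orb_true_r.
  - intros H (n & Hn & Hx).
    assert (E : exists k, (n =? 0) || (halts y (pred n) k && halts y' (pred n) k) = true).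
    { destruct Hn as [->|[HA HB]]; [now exists 0|].
      apply W_halts in HA, HB. destruct HA as [k Hk], HB as [k' Hk'].
      exists (k + k').
      rewrite (halts_mono y (pred n) k), (halts_mono y' (pred n) k'); auto using orb_true_r; lia. }
    destruct E as [k E]. destruct (H n k) as (d & k2 & Hd). rewrite E in Hd. simpl in Hd.
    destruct (Hx (n + d)) as [NA NB]; [lia|]. rewrite W_halts in NA, NB.
    apply orb_true_iff in Hd. destruct Hd; eauto.
Qed.

(** [u] packs the challenge [n], [k]; [v] packs a stage at which both rival codes have halted,
    followed by the answer [d], [k2]. [pred] undoes the shift in [sim]. *)
Definition diag_pred (w u v : nat) : bool :=
  halts (pfst (rival w)) (enc (quad (pfst w))) (pfst v) &&
  halts (psnd (rival w)) (enc (quad (pfst w))) (pfst v) &&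
  diag_test (pred (sim (pfst (rival w)) (enc (quad (pfst w))) (pfst v)))
            (pred (sim (psnd (rival w)) (enc (quad (pfst w))) (pfst v)))
            (pfst u) (psnd u) (pfst (psnd v)) (psnd (psnd v)).

Lemma sim_pred e x k : halts e x k = true -> ev (decode e) x (pred (sim e x k)).
Proof.
  unfold halts. destruct (sim e x k) as [|v] eqn:E; [discriminate|].
  intros _. now apply sim_sound in E.
Qed.

(** The values [y] and [y'] are unique, so their existential quantifiers may move inside the
    quantifier over [u]; determinism identifies the values found for different [u]. *)
Lemma diag_Pi2 w : diag w <-> forall u, exists v, diag_pred w u v = true.
Proof.
  unfold diag, diag_pred.
  generalize (pfst (rival w)) as c, (psnd (rival w)) as c', (enc (quad (pfst w))) as z.
  intros c c' z. split.
  - intros (y & y' & Hy & Hy' & N) u. rewrite diag_test_spec in N.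
    destruct (N (pfst u) (psnd u)) as (d & k2 & Hd).
    apply sim_complete in Hy, Hy'. destruct Hy as [k Hk], Hy' as [k' Hk'].
    apply (sim_mono _ _ _ (k + k')) in Hk; [|lia].
    apply (sim_mono _ _ _ (k + k')) in Hk'; [|lia].
    exists (pair (k + k') (pair d k2)).
    rewrite !psnd_pair, !pfst_pair. unfold halts. now rewrite Hk, Hk'.
  - intros H. destruct (H 0) as [v Hv].
    rewrite !andb_true_iff in Hv. destruct Hv as [[Hc Hc'] _].
    apply sim_pred in Hc, Hc'.
    eexists _, _. split; [exact Hc|]. split; [exact Hc'|].
    apply diag_test_spec. intros n k. destruct (H (pair n k)) as [v' Hv'].
    rewrite psnd_pair, pfst_pair, !andb_true_iff in Hv'.
    destruct Hv' as [[Hd Hd'] Ht]. apply sim_pred in Hd, Hd'.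
    rewrite (ev_functional _ _ _ _ Hc Hd), (ev_functional _ _ _ _ Hc' Hd'). eauto.
Qed.

(** The block of points with first projection [w] is a single class if [diag w] holds, and splits
    into singletons otherwise. *)
Definition diag_rel (x y : nat) : Prop := x = y \/ (pfst x = pfst y /\ diag (pfst x)).

Lemma diag_rel_Pi02_equiv : Pi02_equiv diag_rel.
Proof.
  split.
  - unfold diag_rel. split; [auto|]. split.
    + intros x y [->|[E H]]; auto. right. now rewrite <- E.
    + intros x y z [->|[E H]] [->|[E' H']]; auto. right. split; congruence.
  - exists (fun t => if (pfst t =? pfst (psnd t)) ||
      ((pfst (pfst t) =? pfst (pfst (psnd t))) &&
       diag_pred (pfst (pfst t)) (pfst (psnd (psnd t))) (pfst (psnd (psnd (psnd t)))))
      then 0 else 1).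
    split.
    + match goal with |- computable (fun x => if @?b x then 0 else 1) =>
        change (computable_pred b) end.
      unfold diag_pred, diag_test, rival, quad. cbn [enc fold_right].
      repeat (computability; first [apply computable_sim | apply computable_halts]).
      all: computability.
    + intros x y. cbn [enc fold_right]. unfold diag_rel. rewrite diag_Pi2. split.
      * intros [->|[E H]] u.
        -- exists 0. now rewrite !psnd_pair, !pfst_pair, Nat.eqb_refl.
        -- destruct (H u) as [v Hv]. exists v.
           rewrite !psnd_pair, !pfst_pair, Hv, E, Nat.eqb_refl. now rewrite orb_true_r.
      * intros H. destruct (Nat.eq_dec x y) as [|Hne]; auto. right.
        assert (G : forall u, exists v, pfst x = pfst y /\ diag_pred (pfst x) u v = true).
        { intros u. destruct (H u) as [v Hv]. exists v.
          rewrite !psnd_pair, !pfst_pair in Hv.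
          apply Nat.eqb_neq in Hne. rewrite Hne in Hv. simpl in Hv.
          destruct (Nat.eqb_spec (pfst x) (pfst y)); [|discriminate].
          destruct (diag_pred _ u v); [auto | discriminate]. }
        split; [now destruct (G 0)|]. intros u. destruct (G u) as [v [_ Hv]]. eauto.
Qed.

(* Since [diag w] is the negation of "the two values have equal finite maxima", a
   correct reduction must make [diag w] true and both maxima infinite. *)
Lemma diag_forces_infinite w y y' :
  ev (decode (pfst (rival w))) (enc (quad (pfst w))) y ->
  ev (decode (psnd (rival w))) (enc (quad (pfst w))) y' ->
  (diag w <-> Emax y y') -> has_max (W y) PosInf.
Proof.
  intros Hy Hy' H.
  assert (N : ~ same_finite_max (W y) (W y')).
  { intros S. pose proof S as S'. apply same_finite_max_same_max, H in S'.
    destruct S' as (u & u' & Hu & Hu' & N). apply N.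
    now rewrite (ev_functional _ _ _ _ Hu Hy), (ev_functional _ _ _ _ Hu' Hy'). }
  apply (same_max_infinite _ (W y')); auto. apply H. exists y, y'. auto.
Qed.

Theorem diag_rel_not_reducible : ~ red_c 4 diag_rel Emax.
Proof.
  intros (g & Hg & H).
  destruct (Hg 0) as [c0 H0]; [lia|]. destruct (Hg 1) as [c1 H1]; [lia|].
  destruct (Hg 2) as [c2 H2]; [lia|]. destruct (Hg 3) as [c3 H3]; [lia|].
  (* The blocks of [e] are exactly those whose rivals are the components of [g], evaluated at the
     tuple [quad e]. *)
  set (e := pair (pair (encode c0) (encode c1)) (pair (encode c2) (encode c3))).
  specialize (H (quad e) eq_refl).
  (* The two points of a block differ in their second projection, so equality cannot be what relates
     them. *)
  assert (D : forall h, diag (pair e h) <->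
    diag_rel (pair (pair e h) 0) (pair (pair e h) 1)).
  { intros h. unfold diag_rel. rewrite !pfst_pair. split; auto.
    intros [E|[_ E]]; auto. apply (f_equal psnd) in E. rewrite !psnd_pair in E. discriminate. }
  assert (I0 : has_max (W (g 0 (enc (quad e)))) PosInf).
  { apply (diag_forces_infinite (pair e 0) _ (g 1 (enc (quad e)))).
    - unfold rival. rewrite psnd_pair, !pfst_pair. simpl. unfold e at 1.
      rewrite !pfst_pair, decode_encode. apply H0.
    - unfold rival. rewrite psnd_pair, !pfst_pair. simpl. unfold e at 1.
      rewrite !pfst_pair, psnd_pair, decode_encode. apply H1.
    - rewrite D. apply (H 0 1); lia. }
  assert (I2 : has_max (W (g 2 (enc (quad e)))) PosInf).
  { apply (diag_forces_infinite (pair e 1) _ (g 3 (enc (quad e)))).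
    - unfold rival. rewrite psnd_pair, !pfst_pair. simpl. unfold e at 1.
      rewrite !psnd_pair, pfst_pair, decode_encode. apply H2.
    - unfold rival. rewrite psnd_pair, !pfst_pair. simpl. unfold e at 1.
      rewrite !psnd_pair, decode_encode. apply H3.
    - rewrite D. apply (H 2 3); lia. }
  (* Both images are infinite, so correctness of [g] would relate points of different blocks. *)
  assert (X : diag_rel (pair (pair e 0) 0) (pair (pair e 1) 0)).
  { apply (H 0 2); [lia | lia |]. apply (same_max_intro _ _ PosInf I0 I2). }
  assert (E : pair e 0 = pair e 1).
  { destruct X as [X|[X _]]; [apply (f_equal pfst) in X|]; now rewrite !pfst_pair in X. }
  apply (f_equal psnd) in E. rewrite !psnd_pair in E. discriminate.
Qed.

Theorem theorem4p2 :
  (forall R : nat -> nat -> Prop, Pi02_equiv R -> red_c 3 R Emax) /\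
  ~ (forall R : nat -> nat -> Prop, Pi02_equiv R -> red_c 4 R Emax).
Proof.
  split; [exact Emax_ternary_complete|].
  intros H. exact (diag_rel_not_reducible (H _ diag_rel_Pi02_equiv)).
Qed.
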